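(* Let $\mathcal{F}=\{A_1,A_2,\ldots,A_m\}\subset\mathbb{C}^{n\times n}$ be irreducible, with $A_j$ being of rank one for $2\le j\le m$ (and no rank condition on $A_1$). Then $\mathcal{F}$ has the finiteness property.
   Context: For a finite set $\mathcal{F}=\{A_1,\ldots,A_m\}$ of complex $n\times n$ matrices and $k\ge 1$, let $\mathcal{F}_k=\{A_{i_1}A_{i_2}\cdots A_{i_k}: 1\le i_j\le m\}$ be the set of all products of length $k$. The joint (equivalently, generalized) spectral radius of $\mathcal{F}$ is $\rho(\mathcal{F})=\lim_{k\to\infty}\max_{A\in\mathcal{F}_k}\|A\|^{1/k}=\limsup_{k\to\infty}\max_{A\in\mathcal{F}_k}\rho(A)^{1/k}$, where $\|\cdot\|$ is any sub-multiplicative matrix norm and $\rho(A)$ is the spectral radius of a matrix $A$ (the two expressions are known to coincide for finite sets). The family $\mathcal{F}$ is irreducible if the matrices in $\mathcal{F}$ have no common non-trivial invariant linear subspace of $\mathbb{C}^n$ (i.e. none other than $\{0\}$ and $\mathbb{C}^n$). The family $\mathcal{F}$ has the finiteness property if there are a positive integer $t$ and a product $A_{i_1}A_{i_2}\cdots A_{i_t}\in\mathcal{F}_t$ with $\rho(\mathcal{F})=\rho(A_{i_1}A_{i_2}\cdots A_{i_t})^{1/t}$. *)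

(* Defs.v *)
From mathcomp Require Import all_boot all_order all_algebra.
From mathcomp Require Import boolp classical_sets reals topology normedtype.
From mathcomp Require Import sequences exp.
From mathcomp Require Import complex.

Set Implicit Arguments.
Unset Strict Implicit.
Unset Printing Implicit Defensive.

Import Order.TTheory GRing.Theory Num.Theory.
Import numFieldNormedType.Exports.

Local Open Scope classical_set_scope.
Local Open Scope complex_scope.
Local Open Scope ring_scope.

(* [eigenvalue] refers to row eigenvectors, which gives the same spectrum. *)
Definition spectral_radius (R : realType) (n : nat) (M : 'M[R[i]]_n) : R :=
  sup [set ComplexField.Normc.normc a | a in [set a | eigenvalue M a]].

(* Nonnegativity of N follows from the homogeneity and triangle axioms. *)
Record submultiplicative_norm (R : realType) (n : nat)
    (N : 'M[R[i]]_n -> R) : Prop := SubmultiplicativeNorm {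
  norm_eq0 : forall M, N M = 0 -> M = 0;
  norm_scale : forall a M, N (a *: M) = ComplexField.Normc.normc a * N M;
  norm_add : forall M1 M2, N (M1 + M2) <= N M1 + N M2;
  norm_mul : forall M1 M2, N (M1 *m M2) <= N M1 * N M2
}.

Definition products (R : realType) (n m : nat) (A : 'I_m -> 'M[R[i]]_n)
    (k : nat) : set 'M[R[i]]_n :=
  [set \prod_(j < k) A (i j) | i in [set: 'I_k -> 'I_m]].

(* For m > 0 and k > 0 the set [products A k] is finite and nonempty, so that
   [sup] is a maximum, and the limit exists by submultiplicativity. *)
Definition joint_spectral_radius (R : realType) (n m : nat)
    (N : 'M[R[i]]_n -> R) (A : 'I_m -> 'M[R[i]]_n) : R :=
  limn (fun k => sup [set N P `^ k%:R^-1 | P in products A k]).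

Definition irreducible_family (R : realType) (n m : nat)
    (A : 'I_m -> 'M[R[i]]_n) : Prop :=
  forall U : {vspace 'cV[R[i]]_n},
    (forall i v, v \in U -> A i *m v \in U) -> U = 0%VS \/ U = fullv.

Definition finiteness_property (R : realType) (n m : nat)
    (N : 'M[R[i]]_n -> R) (A : 'I_m -> 'M[R[i]]_n) : Prop :=
  exists (t : nat) (P : 'M[R[i]]_n),
    [/\ (0 < t)%N, products A t P &
        joint_spectral_radius N A = spectral_radius P `^ t%:R^-1].

(* Main.v *)
Require Import Defs.
From mathcomp Require Import all_boot all_order all_algebra.
From mathcomp Require Import boolp classical_sets reals topology normedtype.
From mathcomp Require Import sequences exp.
From mathcomp Require Import complex.
From mathcomp Require Import lra.

Set Implicit Arguments.
Unset Strict Implicit.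
Unset Printing Implicit Defensive.

Import Order.TTheory GRing.Theory Num.Theory.
Import numFieldNormedType.Exports.

Local Open Scope complex_scope.
Local Open Scope ring_scope.

(** For a rank-one matrix B one has B M B = tr(B M) B, and tr(B M) is the only eigenvalue of B M
    that can be nonzero. So when a word is cut at the occurrences of a rank-one letter j, its
    product is a product of scalars tr(A_j u), one for each block u between consecutive occurrences,
    times one matrix made of the two end pieces and a single A_j. Each scalar is bounded by the
    spectral radius of the word j u.

    Suppose every nonempty word w has spectral radius below r^|w|. The scalars of long blocks are
    small because block products grow at a rate below r, those of short blocks because there are
    finitely many; one rate q' < r then bounds them all with constant 1 ([rank1_word_gap]). Adding
    letters one at a time, starting from the powers of the unrestricted matrix ([mxnorm_exp_le]),
    gives N(w) <= C q^|w| with q < r ([mxnorm_letters_le]).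

    Now let r be the infimum of the growth rates max N(w)^(1/k) over words of length k > 0. Spectral
    radii never exceed r^|w|. The bound applied to r + e shows that the rates converge to r; applied
    to r itself, it shows that strict inequality for all words would push the rates below their
    infimum. Hence some word attains equality. *)

Local Notation normc := ComplexField.Normc.normc.

(** * Uniform gaps below a geometric rate *)

Section Gaps.
Variable R : realType.
Implicit Types (q r C D : R).

Lemma ler_exp k q r : 0 <= q -> q <= r -> q ^+ k <= r ^+ k.
Proof.
by move=> q0 qr; rewrite lerXn2r// nnegrE // (le_trans q0).
Qed.

Lemma powR_invK k r : 0 <= r -> (r `^ k.+1%:R^-1) ^+ k.+1 = r.
Proof.
by move=> r0; rewrite -powR_mulrn ?powR_ge0// -powRrM mulVf ?powRr1 ?pnatr_eq0.
Qed.

Lemma powR_inv_le k q r : 0 <= q -> 0 <= r ->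
  (q `^ k.+1%:R^-1 <= r) = (q <= r ^+ k.+1).
Proof.
move=> q0 r0; rewrite -[in RHS](powR_invK k q0).
by rewrite ler_pXn2r ?nnegrE ?powR_ge0.
Qed.

Lemma seq_lt_gap (T : eqType) (f : T -> R) r (s : seq T) :
  0 < r -> (forall x, x \in s -> f x < r) ->
  exists2 q, 0 < q < r & forall x, x \in s -> f x < q.
Proof.
move=> r_gt0; elim: s => [_|y s IHs fr].
  by exists (r / 2) => //; apply/andP; split; lra.
have [x xs|q /andP[q_gt0 qr] fq] := IHs; first by rewrite fr// inE xs orbT.
have fyr : f y < r by rewrite fr// inE eqxx.
exists (Num.max q ((f y + r) / 2)).
  by rewrite lt_max q_gt0 gt_max qr /=; lra.
move=> x; rewrite inE lt_max => /predU1P[->|xs]; last by rewrite fq.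
by apply/orP; right; lra.
Qed.

(** A constant factor is absorbed by a larger ratio, since D (q/r)^l tends to 0. *)
Lemma eventually_geometric_le D q r :
  0 < q < r -> exists L, forall l, (L <= l)%N -> D * q ^+ l <= r ^+ l.
Proof.
move=> /andP[q_gt0 qr]; have r_gt0 := lt_trans q_gt0 qr.
have qr1 : `|q / r| < 1.
  by rewrite ger0_norm ?divr_ge0 ?ltW// ltr_pdivrMr ?mul1r.
have /cvgr0Pnorm_le/(_ 1 ltr01)[L _ HL] := cvg_geometric D qr1.
exists L => l Ll; have := HL l Ll => /= /(le_trans (ler_norm _)).
rewrite expr_div_n mulrA ler_pdivrMr ?mul1r//.
exact: exprn_gt0.
Qed.

(** There are finitely many words of length below L, so their strict inequalities leave a common
    gap. The exponent is the size plus one because w will be a block preceded by one rank-one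
    letter. *)
Lemma short_seq_gap (T : finType) (f : seq T -> R) r :
  0 < r -> (forall w, 0 <= f w < r ^+ (size w).+1) ->
  forall L, exists2 q, 0 < q < r &
    forall w, (size w < L)%N -> f w <= q ^+ (size w).+1.
Proof.
move=> r_gt0 fr; elim=> [|L [q /andP[q_gt0 qr] fq]].
  by exists (r / 2) => //; apply/andP; split; lra.
have [||q' /andP[q'_gt0 q'r] fq'] :=
    @seq_lt_gap _ (fun t : L.-tuple T => f t `^ L.+1%:R^-1) r (enum {: L.-tuple T}).
- by [].
- move=> t _; have /andP[f0] := fr t; rewrite size_tuple => ft.
  by rewrite -(ltr_pXn2r (ltn0Sn L)) ?nnegrE ?powR_ge0 ?ltW// powR_invK.
exists (Num.max q q'); first by rewrite lt_max q_gt0 gt_max qr.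
move=> w; rewrite ltnS leq_eqVlt => /predU1P[sw|sw]; last first.
  apply: le_trans (fq _ sw) _.
  by apply: ler_exp; rewrite ?le_max ?lexx// ltW.
have /andP[f0 _] := fr w.
have := fq' (Tuple (introT eqP sw)); rewrite mem_enum => /(_ isT) /= fw.
rewrite -[f w](powR_invK L f0) sw ler_exp ?powR_ge0//.
by rewrite le_max (ltW fw) orbT.
Qed.

End Gaps.

(** * Matrix norms, eigenvalues and rank-one matrices *)

Section MatrixNorm.
Variables (R : realType) (n : nat) (N : 'M[R[i]]_n -> R).
Hypothesis N_norm : submultiplicative_norm N.
Implicit Types (M B : 'M[R[i]]_n) (a : R[i]).

Lemma normc_ge0 a : 0 <= normc a.
Proof. by case: a => x y; rewrite sqrtr_ge0. Qed.

Lemma mxnorm0 : N 0 = 0.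
Proof.
by rewrite -[in LHS](scale0r 0) (norm_scale N_norm) ComplexField.Normc.normc0 mul0r.
Qed.

Lemma mxnorm_ge0 M : 0 <= N M.
Proof.
have NN : N (- M) = N M.
  rewrite -scaleN1r (norm_scale N_norm).
  by rewrite (normcN (1 : R[i])) ComplexField.Normc.normc1 mul1r.
have := norm_add N_norm M (- M); rewrite subrr mxnorm0 NN; lra.
Qed.

Lemma mxnorm_gt0 M : M != 0 -> 0 < N M.
Proof.
move=> M0; rewrite lt_neqAle mxnorm_ge0 andbT eq_sym.
by apply: contraNneq M0 => /(norm_eq0 N_norm)->.
Qed.

(** [N] measures square matrices only, so the row eigenvector is repeated in all rows of a square V;
    then V M = a V and submultiplicativity applies. *)
Lemma eigenvalue_le_mxnorm M a : eigenvalue M a -> normc a <= N M.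
Proof.
move=> /eigenvalueP[v vM v0]; pose V : 'M[R[i]]_n := \matrix_(j < n) v.
have VM : V *m M = a *: V.
  by apply/row_matrixP => j; rewrite row_mul linearZ /= !rowK.
have /mxnorm_gt0 NV : V != 0.
  apply: contraNneq v0 => V0; apply/eqP/rowP => j.
  by have /rowP/(_ j) := congr1 (row j) V0; rewrite rowK !mxE.
by rewrite -(ler_pM2r NV) -(norm_scale N_norm) -VM mulrC norm_mul.
Qed.

Lemma eigenvalueX M a k : eigenvalue M a -> eigenvalue (M ^+ k) (a ^+ k).
Proof.
move=> /eigenvalueP[v vM v0]; apply/eigenvalueP; exists v => //.
elim: k => [|k IHk]; first by rewrite !expr0 mulmx1 scale1r.
by rewrite exprSr -mulmxE mulmxA IHk -scalemxAl vM scalerA -exprSr.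
Qed.

Lemma normcX a k : normc (a ^+ k) = normc a ^+ k.
Proof.
elim: k => [|k IHk]; first by rewrite !expr0 ComplexField.Normc.normc1.
by rewrite !exprS ComplexField.Normc.normcM IHk.
Qed.

Lemma eigenvalue_le_spectral_radius M a :
  eigenvalue M a -> normc a <= spectral_radius M.
Proof.
move=> aM; apply: ub_le_sup; last by exists a.
by exists (N M) => _ [b bM <-]; apply: eigenvalue_le_mxnorm.
Qed.

(** Write B = u v with u a column and v a row: the inner factor v M u is a scalar, equal to tr(B M)
    by cyclicity. *)
Lemma rank1_mul_mul B M : \rank B = 1%N -> B *m M *m B = \tr (B *m M) *: B.
Proof.
move=> rB; move: (col_base B) (row_base B) (mulmx_base B).
rewrite rB => u v <-; rewrite -(mulmxA u v M) mxtrace_mulC.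
rewrite [LHS]mulmxA -(mulmxA u _ u) [v *m M *m u]mx11_scalar.
by rewrite mxtrace_scalar mulr1n mul_mx_scalar -scalemxAl.
Qed.

Lemma rank1_trace_mul_le B M :
  \rank B = 1%N -> normc (\tr (B *m M)) <= N B * N M.
Proof.
move=> rB; have NB : 0 < N B by rewrite mxnorm_gt0// -mxrank_eq0 rB.
rewrite -(ler_pM2r NB) -(norm_scale N_norm) -rank1_mul_mul//.
apply: le_trans (norm_mul N_norm _ _) _.
by rewrite ler_pM2r// norm_mul.
Qed.

End MatrixNorm.

(** * Spectral radius and growth of the powers of one matrix *)

Section SquareMatrix.
Variables (R : realType) (n' : nat).
Local Notation n := n'.+1.
Variable N : 'M[R[i]]_n -> R.
Hypothesis N_norm : submultiplicative_norm N.
Implicit Types (M B X : 'M[R[i]]_n) (a : R[i]).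

Lemma exists_eigenvalue M : exists a, eigenvalue M a.
Proof.
have /closed_rootP[a aM] : size (char_poly M) != 1%N by rewrite size_char_poly.
by exists a; rewrite eigenvalue_root_char.
Qed.

Lemma spectral_radius_ge0 M : 0 <= spectral_radius M.
Proof.
have [a aM] := exists_eigenvalue M.
exact: le_trans (normc_ge0 a) (eigenvalue_le_spectral_radius N_norm aM).
Qed.

Lemma spectral_radius_le M r :
  (forall a, eigenvalue M a -> normc a <= r) -> spectral_radius M <= r.
Proof.
move=> Mr; apply: ge_sup; last by move=> _ [a aM <-]; apply: Mr.
by have [a aM] := exists_eigenvalue M; exists (normc a), a.
Qed.

(** Since (B M)(B M) = tr(B M) B M, any nonzero row of B M is a row eigenvector for the trace. *)
Lemma rank1_trace_le_spectral_radius B M :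
  \rank B = 1%N -> normc (\tr (B *m M)) <= spectral_radius (B *m M).
Proof.
move=> rB; have [BM0|BM0] := eqVneq (B *m M) 0.
  by rewrite {1}BM0 mxtrace0 ComplexField.Normc.normc0 spectral_radius_ge0.
apply: (eigenvalue_le_spectral_radius N_norm).
have : exists j, row j (B *m M) != 0.
  apply/existsP; apply: contraNT BM0; rewrite negb_exists => /forallP r0.
  by apply/eqP/row_matrixP => j; rewrite row0; apply/eqP; have := r0 j; rewrite negbK.
case=> j rj; apply/eigenvalueP; exists (row j (B *m M)) => //.
by rewrite -row_mul mulmxA rank1_mul_mul// -scalemxAl linearZ.
Qed.

(** One root is removed at a time: Y = (M - z) X is annihilated by the remaining factors, and
    M^(k+1) X = z M^k X + M^k Y is a first-order recurrence whose forcing term is already bounded.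
    This avoids Jordan forms. *)
Lemma annihilated_geometric_bound M (s : seq R[i]) q :
  0 < q -> (forall z, z \in s -> normc z < q) ->
  forall X, horner_mx M (\prod_(z <- s) ('X - z%:P)) *m X = 0 ->
  exists2 C, 0 <= C & forall k, N (M ^+ k *m X) <= C * q ^+ k.
Proof.
move=> q_gt0; elim: s => [_ X|z s IHs zq X].
  rewrite big_nil rmorph1 mul1mx => ->; exists 0 => // k.
  by rewrite mulmx0 (mxnorm0 N_norm) mul0r.
rewrite big_cons mulrC rmorphM /= -mulmxE -mulmxA => sX.
have [y ys|C C0 HC] := IHs _ _ sX; first by rewrite zq// inE ys orbT.
have zltq : normc z < q by rewrite zq// inE eqxx.
(* D solves |z| D + C = q D, so any constant at least D survives a step of the recurrence; N X
   covers k = 0. *)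
set D := C / (q - normc z); have D0 : 0 <= D by rewrite divr_ge0// subr_ge0 ltW.
exists (Num.max (N X) D) => [|k]; first by rewrite le_max D0 orbT.
elim: k => [|k IHk]; first by rewrite !expr0 mul1mx mulr1 le_max lexx.
have -> : M ^+ k.+1 *m X =
    z *: (M ^+ k *m X) + M ^+ k *m (horner_mx M ('X - z%:P) *m X).
  rewrite rmorphB /= horner_mx_X horner_mx_C mulmxBl mulmxBr mul_scalar_mx.
  by rewrite -scalemxAr addrC subrK mulmxA mulmxE -exprSr.
apply: le_trans (norm_add N_norm _ _) _; rewrite (norm_scale N_norm).
have CD : C <= Num.max (N X) D * (q - normc z).
  by rewrite -ler_pdivrMr ?subr_gt0// le_max lexx orbT.
have := ler_wpM2l (normc_ge0 z) IHk; have := HC k.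
have := ler_wpM2r (exprn_ge0 k (ltW q_gt0)) CD.
rewrite exprS; set m := Num.max _ _; set p := q ^+ k.
by move=> h1 h2 h3; apply: le_trans (lerD h3 (le_trans h2 h1)) _; lra.
Qed.

                                                                        
                                                                               
(** The finitely many eigenvalues have moduli below a common q < r, and by Cayley-Hamilton the
    characteristic polynomial annihilates the identity. *)
Lemma mxnorm_exp_le M r : spectral_radius M < r ->
  exists2 q, 0 < q < r & exists2 C, 0 <= C & forall k, N (M ^+ k) <= C * q ^+ k.
Proof.
move=> Mr; have r_gt0 := le_lt_trans (spectral_radius_ge0 M) Mr.
have [s char_s] := closed_field_poly_normal (char_poly M).
have charM : char_poly M = \prod_(z <- s) ('X - z%:P).
  by rewrite {1}char_s (monicP (char_poly_monic M)) scale1r.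
have [z zs|q q0r sq] := @seq_lt_gap R _ (fun z : R[i] => normc z) r s r_gt0.
  apply: le_lt_trans Mr; apply: (eigenvalue_le_spectral_radius N_norm).
  by rewrite eigenvalue_root_char charM root_prod_XsubC.
exists q => //; have /andP[q_gt0 _] := q0r.
have [|C C0 HC] := @annihilated_geometric_bound M s q q_gt0 sq 1%:M.
  by rewrite -charM Cayley_Hamilton mul0mx.
by exists C => // k; have := HC k; rewrite mulmx1.
Qed.

(** * Words and their growth under rank-one letters *)

Section Words.
Variables (m : nat) (A : 'I_m -> 'M[R[i]]_n).
Implicit Types w : seq 'I_m.

Definition word_prod w : 'M[R[i]]_n := \prod_(j <- w) A j.

Lemma word_prod_cat w1 w2 :
  word_prod (w1 ++ w2) = word_prod w1 *m word_prod w2.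
Proof. exact: big_cat. Qed.

Lemma word_prod_cons j w : word_prod (j :: w) = A j *m word_prod w.
Proof. exact: big_cons. Qed.

Lemma products_word_prod k P :
  products A k P <-> exists2 w, size w = k & P = word_prod w.
Proof.
split=> [[i _ <-]|[w <- ->]].
  exists (mktuple i); first by rewrite size_tuple.
  by rewrite /word_prod big_tuple; apply: eq_bigr => j _; rewrite tnth_mktuple.
exists (tnth (in_tuple w)) => //.
by rewrite /word_prod [RHS]big_tnth.
Qed.

(** The absence of a constant in front of the power of q' is essential: these bounds get multiplied
    over arbitrarily many blocks. Long blocks use the norm bound, short ones the spectral radius of
    j w. *)
Lemma rank1_word_gap (j : 'I_m) (P : pred 'I_m) q r C :
  \rank (A j) = 1%N -> 0 < q < r -> 0 <= C ->
  (forall w, (0 < size w)%N -> spectral_radius (word_prod w) < r ^+ size w) ->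
  (forall w, all P w -> N (word_prod w) <= C * q ^+ size w) ->
  exists2 q', q <= q' < r & forall w, all P w ->
    normc (\tr (A j *m word_prod w)) <= q' ^+ (size w).+1.
Proof.
move=> rj /andP[q_gt0 qr] C0 spec wC; have r_gt0 := lt_trans q_gt0 qr.
pose q1 := (q + r) / 2.
have q1_gt0 : 0 < q1 by rewrite /q1; lra.
(* Dividing by q1 makes room for the letter j: N(A_j) C q^l <= q1^(l+1) for l >= L. *)
have [|L HL] := @eventually_geometric_le R (N (A j) * C / q1) q q1.
  by rewrite q_gt0 /q1; lra.
have [|q2 /andP[q2_gt0 q2r] Hq2] :=
    @short_seq_gap R _ (fun w => normc (\tr (A j *m word_prod w))) r r_gt0 _ L.
  move=> w; rewrite normc_ge0 /= -word_prod_cons.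
  apply: le_lt_trans (spec (j :: w) isT).
  by rewrite word_prod_cons rank1_trace_le_spectral_radius.
exists (Num.max q1 q2).
  by rewrite le_max gt_max q2r andbT /q1; apply/andP; split; [apply/orP; left; lra|lra].
move=> w Pw; have [Lw|wL] := leqP L (size w); last first.
  by apply: le_trans (Hq2 _ wL) _; apply: ler_exp; rewrite ?le_max ?lexx ?orbT// ltW.
apply: le_trans (rank1_trace_mul_le N_norm _ rj) _.
apply: (@le_trans _ _ (q1 ^+ (size w).+1)); last first.
  by apply: ler_exp; rewrite ?le_max ?lexx// ltW.
apply: le_trans (ler_wpM2l (mxnorm_ge0 N_norm _) (wC _ Pw)) _.
have := ler_wpM2r (ltW q1_gt0) (HL _ Lw).
by rewrite [_ / q1 * _]mulrAC divfK ?gt_eqF// -exprSr mulrA.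
Qed.

                                                                         
                                                                               
                                                              
(** Induction on the largest letter allowed. When j = p + 1 is added, j w1 j w2 equals tr(A_j w1)
    times j w2, so each return to j costs only a factor q'^(|w1|+1). *)
Lemma mxnorm_letters_le r (p : nat) : (0 < m)%N ->
  (forall j : 'I_m, (0 < j)%N -> \rank (A j) = 1%N) ->
  (forall w, (0 < size w)%N -> spectral_radius (word_prod w) < r ^+ size w) ->
  exists2 q, 0 < q < r & exists2 C, 0 <= C &
    forall w, all (fun j : 'I_m => (j <= p)%N) w ->
      N (word_prod w) <= C * q ^+ size w.
Proof.
move=> m_gt0 rank1 spec; elim: p => [|p [q q0r [C C0 wC]]].
  pose j0 := Ordinal m_gt0.
  have [|q q0r [C C0 HC]] := @mxnorm_exp_le (A j0) r.
    by have := spec [:: j0] isT; rewrite /word_prod big_seq1 expr1.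
  exists q => //; exists C => // w w0.
  suff -> : word_prod w = A j0 ^+ size w by [].
  elim: w w0 => [_|j w IHw /= /andP[jl0 /IHw]].
    by rewrite /word_prod big_nil expr0.
  rewrite word_prod_cons => ->; rewrite exprS mulmxE.
  by congr (A _ * _); apply: val_inj; apply/eqP; rewrite -leqn0.
have [mp|pm] := leqP m p.+1.
  exists q => //; exists C => // w _; apply: wC.
  by apply/allP => j _; rewrite -ltnS (leq_trans (ltn_ord j)).
pose j := Ordinal pm; have rj := rank1 j isT.
have [q' /andP[qq' q'r] trq'] := rank1_word_gap rj q0r C0 spec wC.
have /andP[q_gt0 qr] := q0r; have q'_gt0 := lt_le_trans q_gt0 qq'.
(* The cut is at the first occurrence of j, so that w1 uses only the old letters. *)
have split_word w : all (fun l : 'I_m => (l <= p.+1)%N) w ->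
    all (fun l : 'I_m => (l <= p)%N) w \/
    exists w1 w2, [/\ w = w1 ++ j :: w2, all (fun l : 'I_m => (l <= p)%N) w1
      & all (fun l : 'I_m => (l <= p.+1)%N) w2].
  elim: w => [|l w IHw] /=; first by left.
  move=> /andP[lp wp]; have [lj|lj] := eqVneq l j.
    by right; exists [::], w; rewrite lj.
  have {}lp : (l <= p)%N.
    by move: lp; rewrite leq_eqVlt => /predU1P[lp|//]; rewrite -val_eqE /= lp eqxx in lj.
  rewrite lp; case: (IHw wp) => [|[w1 [w2 [-> w1p w2p]]]]; first by left.
  by right; exists (l :: w1), w2; rewrite /= lp.
have wC' w : all (fun l : 'I_m => (l <= p)%N) w ->
    N (word_prod w) <= C * q' ^+ size w.
  by move=> /wC/le_trans-> //; rewrite ler_wpM2l// ler_exp ?(ltW q_gt0).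
(* D settles the case where j does not recur: N(A_j) C q'^|w| = D q'^(|w|+1). Later recurrences
   leave D unchanged. *)
pose D := N (A j) * C / q'.
have D0 : 0 <= D by rewrite divr_ge0 ?mulr_ge0 ?(mxnorm_ge0 N_norm)// ltW.
have jw_le w : all (fun l : 'I_m => (l <= p.+1)%N) w ->
    N (A j *m word_prod w) <= D * q' ^+ (size w).+1.
  have [k] := ubnP (size w); elim: k w => // k IHk w wk wp.
  case: (split_word w wp) => [w_p|[w1 [w2 [defw w1p w2p]]]].
    apply: le_trans (norm_mul N_norm _ _) _.
    apply: le_trans (ler_wpM2l (mxnorm_ge0 N_norm _) (wC' _ w_p)) _.
    by rewrite exprS [leRHS]mulrA divfK ?gt_eqF// mulrA.
  move: wk; rewrite defw word_prod_cat word_prod_cons !mulmxA rank1_mul_mul//.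
  rewrite -scalemxAl (norm_scale N_norm) size_cat /= addnS ltnS => wk.
  have w2k : (size w2 < k)%N by apply: leq_ltn_trans wk; rewrite leq_addl.
  rewrite -addnS -addSn exprD mulrCA.
  by apply: ler_pM; rewrite ?normc_ge0 ?mxnorm_ge0 ?trq' ?IHk.
exists q'; first by rewrite q'_gt0.
(* C serves words without j; C D serves w1 j w2, with C for w1 and D for j w2. *)
exists (Num.max C (C * D)); first by rewrite le_max C0.
move=> w /split_word[/wC'/le_trans->//|[w1 [w2 [-> w1p w2p]]]].
  by rewrite ler_wpM2r ?exprn_ge0 ?(ltW q'_gt0)// le_max lexx.
rewrite word_prod_cat word_prod_cons size_cat /= exprD.
apply: le_trans (norm_mul N_norm _ _) _.
apply: (@le_trans _ _ (C * D * (q' ^+ size w1 * q' ^+ (size w2).+1))).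
  by rewrite mulrACA; apply: ler_pM; rewrite ?mxnorm_ge0 ?wC' ?jw_le.
by rewrite ler_wpM2r ?mulr_ge0 ?exprn_ge0 ?(ltW q'_gt0)// le_max lexx orbT.
Qed.

Lemma mxnorm_word_le r : (0 < m)%N ->
  (forall j : 'I_m, (0 < j)%N -> \rank (A j) = 1%N) ->
  (forall w, (0 < size w)%N -> spectral_radius (word_prod w) < r ^+ size w) ->
  exists2 q, 0 < q < r & exists2 C, 0 <= C &
    forall w, N (word_prod w) <= C * q ^+ size w.
Proof.
move=> m_gt0 rank1 spec.
have [q q0r [C C0 wC]] := mxnorm_letters_le m m_gt0 rank1 spec.
exists q => //; exists C => // w; apply: wC.
by apply/allP => j _; rewrite ltnW.
Qed.

(** * The joint spectral radius as an infimum of growth rates *)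

Hypothesis m_gt0 : (0 < m)%N.

Let norm_growth k : R :=
  sup [set N P `^ k%:R^-1 | P in products A k]%classic.

Lemma norm_growth_ge w :
  N (word_prod w) `^ (size w)%:R^-1 <= norm_growth (size w).
Proof.
apply: ub_le_sup; last first.
  by exists (word_prod w) => //; apply/products_word_prod; exists w.
set k := size w.
exists (\big[Num.max/0]_(t : k.-tuple 'I_m) N (word_prod t) `^ k%:R^-1).
move=> _ [_ /products_word_prod[u /eqP uk ->] <-].
exact: (le_bigmax _ (fun t : k.-tuple 'I_m => N (word_prod t) `^ k%:R^-1) (Tuple uk)).
Qed.

Lemma norm_growth_le k r :
  (forall w, size w = k -> N (word_prod w) `^ k%:R^-1 <= r) -> norm_growth k <= r.
Proof.
move=> kr; apply: ge_sup; last by move=> _ [_ /products_word_prod[w wk ->] <-]; apply: kr.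
exists (N (word_prod (nseq k (Ordinal m_gt0))) `^ k%:R^-1).
exists (word_prod (nseq k (Ordinal m_gt0))) => //.
by apply/products_word_prod; exists (nseq k (Ordinal m_gt0)); rewrite ?size_nseq.
Qed.

Lemma norm_growth_ge0 k : 0 <= norm_growth k.
Proof.
have := norm_growth_ge (nseq k (Ordinal m_gt0)); rewrite size_nseq.
by apply: le_trans; rewrite powR_ge0.
Qed.

Lemma mxnorm_le_norm_growth w k :
  size w = k.+1 -> N (word_prod w) <= norm_growth k.+1 ^+ k.+1.
Proof.
move=> wk; rewrite -powR_inv_le ?norm_growth_ge0 ?(mxnorm_ge0 N_norm)// -wk.
exact: norm_growth_ge.
Qed.

Lemma mxnorm_blocks_le w k t : size w = (t.+1 * k.+1)%N ->
  N (word_prod w) <= (norm_growth k.+1 ^+ k.+1) ^+ t.+1.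
Proof.
elim: t w => [|t IHt] w wt.
  by rewrite expr1 mxnorm_le_norm_growth// wt mul1n.
rewrite -(cat_take_drop k.+1 w) word_prod_cat exprS.
apply: le_trans (norm_mul N_norm _ _) _.
apply: ler_pM; rewrite ?mxnorm_ge0 ?mxnorm_le_norm_growth ?IHt//.
  by rewrite size_takel// wt mulSn leq_addr.
by rewrite size_drop wt [in LHS]mulSn addKn.
Qed.

(** As k + 1 need not divide the length of w, the word is repeated k + 1 times and the result cut
    into t + 1 blocks of length k + 1. *)
Lemma spectral_radius_le_norm_growth w k t :
  size w = t.+1 -> spectral_radius (word_prod w) <= norm_growth k.+1 ^+ t.+1.
Proof.
move=> wt; apply: spectral_radius_le => a aw.
rewrite -(ler_pXn2r (ltn0Sn k)) ?nnegrE ?normc_ge0 ?exprn_ge0 ?norm_growth_ge0//.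
rewrite -normcX (le_trans (eigenvalue_le_mxnorm N_norm (eigenvalueX k.+1 aw)))//.
have -> : word_prod w ^+ k.+1 = word_prod (flatten (nseq k.+1 w)).
  elim: k.+1 => [|l IHl]; first by rewrite expr0 /word_prod big_nil.
  by rewrite exprS IHl /= word_prod_cat.
rewrite exprAC mxnorm_blocks_le//.
elim: k.+1 => [|l IHl]; first by rewrite muln0.
by rewrite /= size_cat IHl wt mulnS.
Qed.

(** Lengths start at 1, since the exponent [0%:R^-1] is 0 and carries no growth rate. *)
Let r := inf [set norm_growth k.+1 | k in [set: nat]]%classic.

Lemma inf_norm_growth_le k : r <= norm_growth k.+1.
Proof.
by apply: ge_inf; [exists 0 => _ [l _ <-]; exact: norm_growth_ge0 | exists k].
Qed.

Lemma inf_norm_growth_ge c : (forall k, c <= norm_growth k.+1) -> c <= r.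
Proof.
by move=> cg; apply: lb_le_inf; [exists (norm_growth 1), 0%N | move=> _ [k _ <-]].
Qed.

Lemma inf_norm_growth_ge0 : 0 <= r.
Proof. by apply: inf_norm_growth_ge => k; exact: norm_growth_ge0. Qed.

Lemma spectral_radius_le_inf_norm_growth w : (0 < size w)%N ->
  spectral_radius (word_prod w) <= r ^+ size w.
Proof.
case wt : (size w) => [//|t] _.
rewrite -powR_inv_le ?inf_norm_growth_ge0 ?spectral_radius_ge0//.
apply: inf_norm_growth_ge => k.
rewrite powR_inv_le ?norm_growth_ge0 ?spectral_radius_ge0//.
exact: spectral_radius_le_norm_growth.
Qed.

Hypothesis rank1 : forall j : 'I_m, (0 < j)%N -> \rank (A j) = 1%N.

(** Used twice: with q above the infimum [r] to prove convergence, and with q = [r] to reach a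
    contradiction. *)
Lemma norm_growth_eventually_le q :
  (forall w, (0 < size w)%N -> spectral_radius (word_prod w) < q ^+ size w) ->
  exists2 q', q' < q & exists L, forall k, (L <= k)%N -> norm_growth k.+1 <= q'.
Proof.
move=> spec; have [p /andP[p_gt0 pq] [C C0 HC]] := mxnorm_word_le m_gt0 rank1 spec.
exists ((p + q) / 2); first lra.
have [|L HL] := @eventually_geometric_le R C p ((p + q) / 2); first by rewrite p_gt0; lra.
exists L => k Lk; apply: norm_growth_le => w wk.
rewrite powR_inv_le ?(mxnorm_ge0 N_norm)//; last by lra.
by rewrite (le_trans (HC w))// wk HL// ltnW.
Qed.

(** The rates never fall below [r], and each r + e strictly dominates all spectral radii, so the
    rates are eventually below r + e. *)
Lemma joint_spectral_radius_inf : joint_spectral_radius N A = r.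
Proof.
apply: cvg_lim; first exact: norm_hausdorff.
apply/cvgrPdist_le => e e_gt0.
have [w w_gt0|q qre [L HL]] := @norm_growth_eventually_le (r + e).
  apply: le_lt_trans (spectral_radius_le_inf_norm_growth w_gt0) _.
  by rewrite ltrXn2r ?inf_norm_growth_ge0 -?lt0n// ltrDl.
exists L.+1 => // -[//|k]; rewrite /= ltnS => /HL gq.
rewrite distrC ger0_norm ?subr_ge0 ?inf_norm_growth_le//.
by rewrite lerBlDl (le_trans gq)// ltW.
Qed.

Lemma joint_spectral_radius_attained : exists2 w, (0 < size w)%N &
  joint_spectral_radius N A = spectral_radius (word_prod w) `^ (size w)%:R^-1.
Proof.
rewrite joint_spectral_radius_inf; apply: contrapT => no_word.
(* If no word attains [r], all spectral inequalities are strict and the rates eventually stay below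
   some q < r, against the choice of [r]. *)
have [w w_gt0|q qr [L HL]] := @norm_growth_eventually_le r.
  rewrite lt_neqAle spectral_radius_le_inf_norm_growth// andbT.
  apply/eqP => wr; apply: no_word; exists w => //.
  rewrite wr -powR_mulrn ?inf_norm_growth_ge0// -powRrM.
  by rewrite mulfV ?powRr1 ?inf_norm_growth_ge0// pnatr_eq0 -lt0n.
have := lt_le_trans qr (inf_norm_growth_le L).
by rewrite ltNge HL.
Qed.

End Words.
End SquareMatrix.

Theorem corollary1 (R : realType) (n m : nat) (n_gt0 : (0 < n)%N)
    (m_gt0 : (0 < m)%N) (A : 'I_m -> 'M[R[i]]_n) (N : 'M[R[i]]_n -> R)
    (N_norm : submultiplicative_norm N) (A_irr : irreducible_family A)
    (A_rank1 : forall j : 'I_m, (0 < j)%N -> \rank (A j) = 1%N) :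
  finiteness_property N A.
Proof.
case: n n_gt0 A N N_norm A_irr A_rank1 => // n _ A N N_norm _ A_rank1.
have [w w_gt0 Nw] := joint_spectral_radius_attained N_norm m_gt0 A_rank1.
exists (size w), (word_prod A w); split=> //.
by apply/products_word_prod; exists w.
Qed.
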